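(* Let $p$ be an odd prime and let $G$ be a $d$-maximal finite $p$-group. Then $G/[G,G]$ and $[G,G]$ are elementary abelian $p$-groups. If $|G| > p$, then $|[G,G]| \leq p^{d(G)-2}$.
   Context: $d(G)$ denotes the minimal number of generators of a group $G$. A finite $p$-group $G$ is $d$-maximal if $d(H) < d(G)$ for all proper subgroups $H$ of $G$. $[G,G]$ is the derived subgroup of $G$. *)

(* Defs.v *)
From mathcomp Require Import all_boot all_fingroup all_solvable.

Set Implicit Arguments.
Unset Strict Implicit.
Unset Printing Implicit Defensive.

(* ['m(G)] is the minimal number of generators d(G) for arbitrary finite G
   (not the rank, which is ['r(G)]). *)
Definition d_maximal (gT : finGroupType) (G : {group gT}) : Prop :=
  forall H : {group gT}, H \proper G -> 'm(H)%g < 'm(G)%g.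

(* Main.v *)
Require Import Defs.
From mathcomp Require Import all_boot all_fingroup all_solvable.

Set Implicit Arguments.
Unset Strict Implicit.
Unset Printing Implicit Defensive.

(** Write d for 'm(G). Each step exhibits a subgroup that needs too many
    generators to be proper, and d-maximality passes to quotients by normal
    subgroups of 'Phi(G), since these have the same d ([d_maximal_quotient]).

    The abelianization is such a quotient. In an abelian d-maximal p-group the
    elements of order dividing p form a subgroup of the same rank, which must
    therefore be everything. So G / G^`(1) is elementary abelian,
    of order p ^ d.

    The heart of the matter is that G^`(1) is central
    ([d_maximal_der1_central]). Otherwise a quotient of G is a d-maximal group
    in which K = [~: G^`(1), G] has order p. Put C = 'C_G(G^`(1)), a proper
    subgroup containing G^`(1), and D = G^`(1) :&: 'C(G). Commutation induces a
    nondegenerate pairing of G / C with G^`(1) / D into K, so that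
    #|G : C| <= #|G^`(1) : D| ([index_subcent_leq]) and hence
    #|C : D| >= #|G : G^`(1)| = p ^ d. Yet C / D is elementary abelian (here
    p > 2 is essential), so 'm(C) >= d.

    Once G^`(1) is central, [~ x, y] ^+ p = [~ x ^+ p, y] = 1 because x ^+ p is
    in G^`(1): thus G^`(1) is elementary abelian. Moreover x |-> x ^+ p is now a
    morphism from G to G^`(1). Were its kernel inside G^`(1), the order of
    G^`(1) would be at least #|G : G^`(1)| = p ^ d and 'm(G^`(1)) at least d. So
    some x of order p lies outside G^`(1) ([ex_order_p_notin_der1]), and the
    elementary abelian group G^`(1) \x <[x]> of rank 'm(G^`(1)) + 1 is proper in
    G as soon as #|G| > p: this is the bound on #|G^`(1)|. *)

Section DMaximal.

Local Open Scope group_scope.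

Implicit Types (gT : finGroupType) (p : nat).

(** * Quotients of d-maximal groups *)

(** Burnside's basis theorem in the form that generators of G / N lift to
    generators of G, elements of 'Phi(G) being superfluous in any generating
    set. *)
Lemma quotient_Phi_grank gT (G N : {group gT}) :
  N <| G -> N \subset 'Phi(G) -> 'm(G / N) = 'm(G).
Proof.
move=> nNG sNPhi; have nNG' := normal_norm nNG.
apply/eqP; rewrite eqn_leq quotient_grank //=.
have [B defB <-] := grank_witness (G / N).
have sBG : B \subset G / N by rewrite -defB subset_gen.
pose X : {set gT} := [set repr (Y : {set gT}) | Y : coset_of N in B].
have nXN : X \subset 'N(N).
  by apply/subsetP=> _ /imsetP[Y _ ->]; rewrite repr_coset_norm.
have XB : X / N = B.
  apply/setP=> Y; apply/idP/idP=> [/morphimP[_ _ /imsetP[Z BZ ->] ->]|BY].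
    by move: BZ; rewrite -{1}(coset_reprK Z).
  rewrite -(coset_reprK Y); apply: mem_morphim (repr_coset_norm Y) _.
  by apply/imsetP; exists Y.
have sXG : X \subset G.
  apply/subsetP=> _ /imsetP[Y BY ->].
  have /morphimP[y Ny Gy defY] := subsetP sBG _ BY.
  have := mem_repr_coset Y; rewrite defY val_coset //.
  case/rcosetP=> n Nn ->; rewrite groupM // (subsetP (normal_sub nNG)) //.
have defG : 'Phi(G) <*> X = G.
  apply/eqP; rewrite eqEsubset join_subG Phi_sub sXG /=.
  have nXN' : <<X>> \subset 'N(N) by rewrite gen_subG.
  have: G \subset N <*> <<X>>.
    rewrite norm_joinEr // -quotientSK //.
    by rewrite quotient_gen // XB defB.
  move/subset_trans; apply; rewrite joing_idr.
  by rewrite genS // setSU.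
rewrite -(Phi_nongen defG); apply: leq_trans (grank_min _) _.
exact: leq_imset_card.
Qed.

Lemma d_maximal_quotient gT (G N : {group gT}) :
  d_maximal G -> N <| G -> N \subset 'Phi(G) -> d_maximal (G / N)%G.
Proof.
move=> dmaxG nNG sNPhi K; rewrite /= quotient_Phi_grank // => prKG.
have [H defK sNH sHG] := inv_quotientS nNG (proper_sub prKG).
rewrite /= in defK; rewrite defK.
have prHG : H \proper G.
  rewrite properEneq sHG andbT; apply: contraTneq prKG => eqHG.
  by rewrite defK eqHG properxx.
apply: leq_ltn_trans (dmaxG _ prHG).
by rewrite quotient_grank // (subset_trans sHG) ?normal_norm.
Qed.

(** 'Ohm_1(G) has the same rank as the abelian group G, so it cannot be
    proper. *)
Lemma d_maximal_abelian_abelem gT p (G : {group gT}) :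
  p.-group G -> abelian G -> d_maximal G -> p.-abelem G.
Proof.
move=> pG cGG dmaxG.
suff <- : 'Ohm_1(G) = G by apply: Ohm1_abelem.
apply/eqP; rewrite eqEproper Ohm_sub; apply/negP=> /dmaxG.
by rewrite !grank_abelian ?(abelianS (Ohm_sub _ _)) // rank_Ohm1 ltnn.
Qed.

Lemma d_maximal_abelianization gT p (G : {group gT}) :
  p.-group G -> d_maximal G -> p.-abelem (G / G^`(1)).
Proof.
move=> pG dmaxG; apply: d_maximal_abelian_abelem.
- exact: quotient_pgroup.
- exact: der_abelian 0 G.
apply: d_maximal_quotient; rewrite ?der_normal //.
by rewrite (Phi_joing pG) joing_subl.
Qed.

Lemma abelem_card_grank p (rT : finGroupType) (E : {group rT}) :
  p.-abelem E -> #|E| = (p ^ 'm(E))%N.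
Proof.
move=> abE; rewrite grank_abelian ?(abelem_abelian abE) // (rank_abelem abE).
exact: card_pgroup (abelem_pgroup abE).
Qed.

Lemma d_maximal_card_abelianization gT p (G : {group gT}) :
  p.-group G -> d_maximal G -> #|G : G^`(1)| = (p ^ 'm(G))%N.
Proof.
move=> pG dmaxG; rewrite -card_quotient ?der_norm //.
rewrite (abelem_card_grank (d_maximal_abelianization pG dmaxG)).
by rewrite quotient_Phi_grank ?der_normal // (Phi_joing pG) joing_subl.
Qed.

(** * Centrality of the derived subgroup *)

Lemma leq_indexgI gT (G H K : {group gT}) :
  H \subset G -> (#|G : H :&: K| <= #|G : H| * #|G : K|)%N.
Proof.
move=> sHG; rewrite -(Lagrange_index sHG (subsetIl H K)) leq_mul2l indexgI.
by rewrite subset_leq_card ?imsetS ?orbT.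
Qed.

(** An induction on A in place of duality for the pairing (a, g) |-> [~ a, g]:
    when [~: A, G] has order at most p, adjoining one element a to a subgroup B
    of index p in A shrinks the centralizer by a factor at most p, as the
    conjugates of a lie in the coset a *: [~: A, G]. *)
Lemma index_subcent_leq gT p (G A : {group gT}) :
  p.-group A -> A \subset G -> (#|[~: A, G]| <= p)%N ->
  (#|G : 'C_G(A)| <= #|A : A :&: 'C(G)|)%N.
Proof.
have [n leAn] := ubnP #|A|; elim: n => // n IHn in A leAn *.
move=> pA sAG leAGp.
have [defZ | [B maxB sZB]] := maximal_exists (subsetIl A 'C(G)).
  have cAG: A \subset 'C(G) by rewrite -defZ subsetIr.
  by rewrite (setIidPl _) ?indexgg // centsC.
have [sBA /subsetPn[a Aa notBa]] := andP (maxgroupp maxB).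
have oAB := p_maximal_index pA maxB.
have defA : B * <[a]> = A.
  apply: mulg_normal_maximal (p_maximal_normal pA maxB) maxB _ _.
    by rewrite cycle_subG.
  by rewrite cycle_subG.
have defZ : B :&: 'C(G) = A :&: 'C(G).
  by apply/eqP; rewrite eqEsubset setSI //= subsetI sZB subsetIr.
have -> : 'C_G(A) = 'C_G(B) :&: 'C[a].
  by rewrite -defA centM cent_cycle setIA.
apply: leq_trans (leq_indexgI _ _) _; first exact: subsetIl.
rewrite -(Lagrange_index sBA) -?defZ ?subsetIl // oAB mulnC.
rewrite leq_mul //=; last first.
  rewrite /= -defZ; apply: IHn; rewrite ?(pgroupS sBA) ?(subset_trans sBA) //.
    by apply: leq_trans (proper_card (maxgroupp maxB)) _.
  by apply: leq_trans (subset_leq_card (commSg _ sBA)) leAGp.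
rewrite -indexgI index_cent1 -(card_lcoset _ a^-1).
apply: leq_trans (subset_leq_card _) leAGp.
apply/subsetP=> y; rewrite mem_lcoset invgK.
case/imsetP=> g Gg /(canRL (mulKg _)) ->.
by rewrite -commgEl mem_commg.
Qed.

Lemma mem_expp_der1 gT p (G : {group gT}) x :
  prime p -> p.-group G -> d_maximal G -> x \in G -> x ^+ p \in G^`(1).
Proof.
move=> p_pr pG dmaxG Gx.
have [_ xp1] := abelemP p_pr (d_maximal_abelianization pG dmaxG).
have Nx := subsetP (der_norm 1 G) x Gx.
by apply: coset_idr; rewrite ?groupX // morphX // xp1 ?mem_quotient.
Qed.

(** The critical case of class 3: the centralizer C of G^`(1) would need at
    least 'm(G) generators. *)
Lemma d_maximal_card_lcn3_neq gT p (G : {group gT}) :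
  prime p -> odd p -> p.-group G -> d_maximal G -> #|[~: G^`(1), G]| <> p.
Proof.
move=> p_pr p_odd pG dmaxG oK.
have sG'G : G^`(1) \subset G := der_sub 1 G.
have nKG : [~: G^`(1), G] <| G.
  rewrite /normal commg_normr andbT (subset_trans _ sG'G) //.
  by rewrite commg_subl der_norm.
have sKZ : [~: G^`(1), G] \subset 'Z(G).
  apply: prime_meetG; rewrite ?oK //.
  by rewrite meet_center_nil ?(pgroup_nil pG) // -cardG_gt1 oK prime_gt1.
have cKG : [~: G^`(1), G, G] = 1.
  by apply/commG1P; apply: subset_trans sKZ (subsetIr _ _).
have abG' : abelian G^`(1).
  by apply/commG1P; apply: three_subgroup; rewrite // (commGC G).
pose C := 'C_G(G^`(1))%G; pose D := (G^`(1) :&: 'C(G))%G.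
have sCG : C \subset G := subsetIl _ _.
have sG'C : G^`(1) \subset C by rewrite subsetI sG'G.
have sDC : D \subset C := subset_trans (subsetIl _ _) sG'C.
have nDC : C \subset 'N(D).
  by rewrite cents_norm // centsC (subset_trans (subsetIr _ _)) // centS.
have prC : C \proper G.
  rewrite properEneq sCG andbT; apply/eqP=> /setIidPl; rewrite centsC.
  by move/commG1P=> K1; move: p_pr; rewrite -oK K1 cards1.
(* Three subgroups lemma: [~: C, G] is inside G^`(1), which C centralizes. *)
have sC'D : C^`(1) \subset D.
  rewrite subsetI dergS //=; apply/commG1P.
  have trCGC : [~: C, G, C] = 1.
    apply/commG1P; apply: subset_trans (commSg G sCG) _.
    by rewrite centsC subsetIr.
  by apply: three_subgroup; rewrite // (commGC G).
(* For x in C and g in G, put u = [~ g, x]. As g ^+ p is in G^`(1), x commutes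
   with it, so g ^+ p = (g ^+ p) ^ x = (g * u) ^+ p = g ^+ p * u ^+ p: the
   correction [~ u, g] ^+ 'C(p, 2) is trivial since K has order p and p is odd.
   Hence u ^+ p = 1, which says that g commutes with x ^+ p. *)
have expC x : x \in C -> x ^+ p \in D.
  move=> Cx; have [Gx cG'x] := setIP Cx.
  rewrite inE mem_expp_der1 //=; apply/centP=> g Gg.
  have G'gx : [~ g, x] \in G^`(1) by rewrite mem_commg.
  have Kgxg : [~ [~ g, x], g] \in [~: G^`(1), G] by rewrite mem_commg.
  have cKh h : h \in G -> commute h [~ [~ g, x], g].
    move=> Gh; apply/commute_sym.
    by have/centerP[_] := subsetP sKZ _ Kgxg; apply.
  have gx1 : [~ g, x] ^+ p = 1.
    have: (g * [~ g, x]) ^+ p = g ^+ p.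
      rewrite commgEl mulKVg -conjXg /conjg.
      have cxgp : commute (g ^+ p) x.
        by apply: commute_sym; apply: (centP cG'x); apply: mem_expp_der1.
      by rewrite cxgp mulKg.
    rewrite expMg_Rmul; last 2 first.
    - by apply: cKh; apply: (subsetP sG'G).
    - exact: cKh.
    have: [~ [~ g, x], g] ^+ 'C(p, 2) = 1.
      apply/eqP; rewrite -order_dvdn.
      apply: dvdn_trans (order_dvdG Kgxg) _; rewrite oK.
      by rewrite prime_dvd_bin // odd_prime_gt2.
    by move=> ->; rewrite mulg1 => /(canRL (mulKg _)); rewrite mulVg.
  apply/commgP; rewrite /= commXg -invg_comm ?expgVn ?gx1 ?invg1 //.
  by apply/commuteV; apply: (centP cG'x).
have abCD : p.-abelem (C / D).
  apply/abelemP=> //; split; first exact: sub_der1_abelian.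
  move=> _ /morphimP[x Nx Cx ->].
  by rewrite -morphX //= coset_id ?expC.
have := dmaxG _ prC; rewrite ltnNge => /negP[].
apply: leq_trans (quotient_grank nDC).
rewrite -(leq_exp2l _ _ (prime_gt1 p_pr)) -(abelem_card_grank abCD).
rewrite -d_maximal_card_abelianization // card_quotient //.
rewrite -(Lagrange_index sCG sG'C) -(Lagrange_index sG'C (subsetIl _ _)).
rewrite mulnC leq_mul //.
by apply: (@index_subcent_leq _ p); rewrite ?(pgroupS sG'G) ?oK.
Qed.

(** If K = [~: G^`(1), G] is nontrivial, a subgroup N of index p in K that is
    normal in G reduces to the case where K has order p. *)
Lemma d_maximal_der1_central gT p (G : {group gT}) :
  prime p -> odd p -> p.-group G -> d_maximal G -> G^`(1) \subset 'C(G).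
Proof.
move=> p_pr p_odd pG dmaxG; apply/commG1P/eqP/idPn=> ntK.
set K := [~: G^`(1), G] in ntK.
have sKG' : K \subset G^`(1) by rewrite commg_subl der_norm.
have nKG : K <| G.
  by rewrite /normal (subset_trans sKG') ?der_sub ?commg_normr.
have pK : p.-group K := pgroupS (normal_sub nKG) pG.
have [_ _ [n oK]] := pgroup_pdiv pK ntK.
have [|N [sNK nNG oN]] := @normal_pgroup p gT n G [group of K] pG nKG.
  by rewrite oK pfactorK.
have sNPhi : N \subset 'Phi(G).
  rewrite (Phi_joing pG); apply: subset_trans (joing_subl _ _).
  exact: subset_trans sNK sKG'.
have nNG' := normal_norm nNG.
apply: (@d_maximal_card_lcn3_neq _ p (G / N)%G) => //.
- exact: quotient_pgroup.
- exact: d_maximal_quotient.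
rewrite /= -quotient_der // -quotientR ?(subset_trans (der_sub 1 G)) //.
rewrite -/K card_quotient ?(subset_trans (normal_sub nKG)) //.
by rewrite -divgS //= oN oK expnS mulnK // expn_gt0 prime_gt0.
Qed.

(** * Powers in class 2 *)

(** In class 2, [~ x, y] ^+ p = [~ x ^+ p, y], and x ^+ p is central. *)
Lemma d_maximal_der1_abelem gT p (G : {group gT}) :
  prime p -> odd p -> p.-group G -> d_maximal G -> p.-abelem G^`(1).
Proof.
move=> p_pr p_odd pG dmaxG.
have sG'G : G^`(1) \subset G := der_sub 1 G.
have cG'G := d_maximal_der1_central p_pr p_odd pG dmaxG.
have abG' : abelian G^`(1) by apply: subset_trans cG'G (centS sG'G).
have pG' := pgroupS sG'G pG.
suff <- : 'Ohm_1(G^`(1)) = G^`(1) by apply: Ohm1_abelem.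
apply/eqP; rewrite eqEsubset Ohm_sub /= (OhmE 1 pG') gen_subG.
apply/subsetP=> _ /imset2P[x y Gx Gy ->]; apply: mem_gen.
have G'xy : [~ x, y] \in G^`(1) by rewrite mem_commg.
rewrite !inE G'xy -commXg.
  apply/commgP; apply: (centP (subsetP cG'G _ _)) => //.
  exact: mem_expp_der1.
by apply: commute_sym; apply: (centP (subsetP cG'G _ _)).
Qed.

(** In class 2 with p odd and G^`(1) of exponent p, the p-th power map is a
    morphism from G to G^`(1). It cannot embed G / G^`(1), of order p ^ 'm(G),
    into G^`(1), because 'm(G^`(1)) < 'm(G). *)
Lemma ex_order_p_notin_der1 gT p (G : {group gT}) :
    prime p -> odd p -> p.-group G -> d_maximal G -> G :!=: 1 ->
  exists x, [/\ x \in G, x \notin G^`(1) & x ^+ p = 1].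
Proof.
move=> p_pr p_odd pG dmaxG ntG.
have cG'G := d_maximal_der1_central p_pr p_odd pG dmaxG.
have abG' := d_maximal_der1_abelem p_pr p_odd pG dmaxG.
have [_ expG'] := abelemP p_pr abG'.
have expM : {in G &, {morph (fun x => x ^+ p) : x y / x * y}}.
  move=> x y Gx Gy /=.
  have G'yx : [~ y, x] \in G^`(1) by rewrite mem_commg.
  have cyx z : z \in G -> commute z [~ y, x].
    by move=> Gz; apply: commute_sym; apply: (centP (subsetP cG'G _ _)).
  rewrite expMg_Rmul; try exact: cyx.
  have /dvdnP[k ->]: p %| 'C(p, 2) by rewrite prime_dvd_bin // odd_prime_gt2.
  by rewrite mulnC expgM (expG' _ G'yx) expg1n mulg1.
pose f := Morphism expM.
have [sKG' | /subsetPn[x /morphpreP[Gx /set1P xp1] notG'x]] :=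
  boolP ('ker f \subset G^`(1)); last by exists x.
have prG' : G^`(1) \proper G.
  by rewrite (sol_der1_proper (nilpotent_sol (pgroup_nil pG))).
have := dmaxG _ prG'; rewrite ltnNge => /negP[].
rewrite -(leq_exp2l _ _ (prime_gt1 p_pr)) -(abelem_card_grank abG').
rewrite -(d_maximal_card_abelianization pG dmaxG).
have sfG : f @* G \subset G^`(1).
  by apply/subsetP=> _ /morphimP[x _ Gx ->]; apply: mem_expp_der1.
apply: leq_trans (subset_leq_card sfG); rewrite card_morphim setIid.
by rewrite dvdn_leq ?indexgS.
Qed.

End DMaximal.

(* The truncated subtraction is harmless: a d-maximal p-group with p < #|G|
   has a proper subgroup of order p, hence 'm(G) >= 2. *)
Theorem proposition4p1 (gT : finGroupType) (G : {group gT}) (p : nat)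
    (p_prime : prime p) (p_odd : odd p)
    (pG : (p.-group G)%g) (dmaxG : d_maximal G) :
  [/\ (p.-abelem (G / [~: G, G]))%g,
      (p.-abelem [~: G, G])%g
    & p < #|G| -> #|[~: G, G]%g| <= p ^ ('m(G)%g - 2)].
Proof.
split; first exact: d_maximal_abelianization.
  exact: d_maximal_der1_abelem.
rewrite -derg1 => ltpG.
have ntG : G :!=: 1%g.
  by rewrite -cardG_gt1; apply: leq_ltn_trans ltpG; rewrite prime_gt0.
have [x [Gx notG'x xp1]] := ex_order_p_notin_der1 p_prime p_odd pG dmaxG ntG.
have abG' := d_maximal_der1_abelem p_prime p_odd pG dmaxG.
have sG'G : G^`(1)%g \subset G := der_sub 1 G.
have ox : #[x]%g = p.
  apply: nt_prime_order => //.
  by apply: contraNneq notG'x => ->; rewrite group1.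
have abx : (p.-abelem <[x]>)%g.
  by rewrite cycle_abelem ?p_prime ?ox ?dvdnn ?orbT.
have cG'x : (<[x]> \subset 'C(G^`(1)))%g.
  have cG'G := d_maximal_der1_central p_prime p_odd pG dmaxG.
  by rewrite centsC (subset_trans cG'G) // centS // cycle_subG.
have tiG'x : (G^`(1) :&: <[x]> = 1)%g.
  by rewrite setIC prime_TIg ?cycle_subG // -orderE ox.
have defE : (G^`(1) \x <[x]> = G^`(1) <*> <[x]>)%g by rewrite dprodEY.
have abE : (p.-abelem (G^`(1) <*> <[x]>))%g.
  by rewrite (dprod_abelem _ defE) abG'.
have sEG : (G^`(1) <*> <[x]>)%g \subset G by rewrite join_subG sG'G cycle_subG.
have prE : (G^`(1) <*> <[x]>)%g \proper G.
  (* If it were G, then G would be abelian, hence equal to <[x]>, of order p. *)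
  rewrite properEneq sEG andbT; apply: contraTneq ltpG => defG.
  have G'1 : (G^`(1) = 1)%g by apply/derG1P; rewrite -defG (abelem_abelian abE).
  by rewrite -defG G'1 joing1G -orderE ox ltnn.
have oE := dprod_card defE.
rewrite -(leq_pmul2r (prime_gt0 p_prime)) -{1}ox orderE oE.
rewrite (abelem_card_grank abE) -expnSr leq_exp2l ?prime_gt1 //.
have := dmaxG _ prE; case: 'm(G)%g => // k.
by rewrite ltnS subSS subn1 => /leq_trans-> //; apply: leqSpred.
Qed.
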